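(* Let $\alpha\ge1$ and $E_t^\alpha(u;f):=\frac1\alpha\|Au-f\|_{\mathcal H}^\alpha+tJ(u)$. Then $$S(f):=\sup\{\langle f,Au\rangle: u\in\mathcal N(J)^{\perp,A},\ J(u)=1\}<\infty .$$ Set $$t_{**}:=\frac{S(f)}{\|f-A\mathcal P^A(f)\|_{\mathcal H}^{2-\alpha}}\quad\text{if } f\ne A\mathcal P^A(f),\qquad t_{**}:=0\text{ otherwise}.$$ Then for $t\ge t_{**}$ the element $u_t=\mathcal P^A(f)$ is a minimizer of $E_t^\alpha(\cdot;f)$, and for $t>t_{**}$ it is the unique minimizer. Conversely, if $\mathcal P^A(f)$ is a minimizer of $E_t^\alpha(\cdot;f)$, then $t\ge t_{**}$.
   Context: Setting: $\mathcal X$ is the (real) Banach space dual of a separable Banach space $\mathcal Y$; $\mathcal H$ is a real Hilbert space; $A:\mathcal X\to\mathcal H$ is bounded and linear. $J:\mathcal X\to[0,\infty]$ is convex, proper, weak$^*$ lower semi-continuous and absolutely one-homogeneous ($J(cu)=|c|J(u)$). $\mathcal N(J)=\{u:J(u)=0\}$. The datum $f\in\mathcal H$ is such that any $u\in\mathcal X$ with $Au=f$ satisfies $J(u)\ne 0$. The regularization parameter satisfies $t\ge0$, and $E_t^\alpha(u;f)=+\infty$ if $J(u)=\infty$. For $g\in\mathcal H$, $\mathcal P^A(g)\in\mathcal N(J)$ denotes the (unique) minimizer of $\|Au-g\|_{\mathcal H}$ over $u\in\mathcal N(J)$. For $U\subset\mathcal X$, the $A$-orthogonal complement is $U^{\perp,A}:=\{v\in\mathcal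 X:\langle Av,Au\rangle=0\ \forall u\in U\}$. Standing assumptions: (1) $u\mapsto\|Au\|_{\mathcal H}$ is a norm on $\mathcal N(J)$ equivalent to the restriction of $\|\cdot\|_{\mathcal X}$. (2) There is $C>0$ with $\|u-\mathcal P^A(Au)\|_{\mathcal X}\le C J(u)$ for all $u\in\mathcal X$. (3) $A$ is weak$^*$-to-weak continuous: $u_k\rightharpoonup^* u$ in $\mathcal X$ implies $Au_k\rightharpoonup Au$ in $\mathcal H$. *)

(* Defs.v *)
From mathcomp Require Import all_boot all_order all_algebra.
From mathcomp Require Import all_classical all_reals all_analysis.

Set Implicit Arguments.
Unset Strict Implicit.
Unset Printing Implicit Defensive.

Import Order.TTheory GRing.Theory Num.Theory.
Import numFieldNormedType.Exports.

Local Open Scope classical_set_scope.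
Local Open Scope ring_scope.

Definition separable_space (T : topologicalType) : Prop :=
  exists2 D : set T, countable D & dense D.

(* [pairing x y] is the value of the functional x at y: it identifies X,
   isometrically, with the space of all continuous linear functionals on Y
   under the operator norm. *)
Record is_dual_of (R : realType) (X Y : normedModType R)
    (pairing : X -> Y -> R) : Prop := IsDualOf {
  dual_scalar : forall x, scalar (pairing x);
  dual_continuous : forall x, continuous (pairing x);
  dual_onto : forall phi : Y -> R, scalar phi -> continuous phi ->
    exists x, pairing x = phi;
  dual_linear : forall y, scalar (pairing ^~ y);
  dual_norm : forall x,
    `|x| = sup [set `|pairing x y| | y in [set y | `|y| <= 1]]
}.

(* The topology of pointwise convergence on Y. *)
Notation weak_star pairing :=
  (initial_topology (pairing : _ -> {ptws _ -> _})).

Definition weak_star_lsc (R : realType) (X Y : normedModType R)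
    (pairing : X -> Y -> R) (J : X -> \bar R) : Prop :=
  lower_semicontinuous (J : weak_star pairing -> \bar R).

Definition weak_star_cvg (R : realType) (X Y : normedModType R)
    (pairing : X -> Y -> R) (u : nat -> X) (l : X) : Prop :=
  (u : nat -> weak_star pairing) @ \oo --> (l : weak_star pairing).

Definition weak_cvg (R : realType) (E : normedModType R)
    (u : nat -> E) (l : E) : Prop :=
  forall phi : E -> R, scalar phi -> continuous phi ->
    phi (u k) @[k --> \oo] --> phi l.

Definition weak_star_to_weak_continuous (R : realType)
    (X Y H : normedModType R) (pairing : X -> Y -> R) (A : X -> H) : Prop :=
  forall (u : nat -> X) (l : X),
    weak_star_cvg pairing u l -> weak_cvg (A \o u) (A l).

(* The norm of H is the one induced by the inner product; together with the
   completeness of H this makes H a Hilbert space. *)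
Definition norm_of_dot (R : realType) (H : normedModType R)
    (dot : {dot H for idfun}) : Prop :=
  forall h : H, `|h| = Num.sqrt (dot h h).

Definition bounded_operator (R : realType) (X H : normedModType R)
    (A : X -> H) : Prop :=
  exists M : R, forall u, `|A u| <= M * `|u|.

Section functionals.
Context {R : realType} {X : lmodType R}.
Implicit Types J : X -> \bar R.
Local Open Scope ereal_scope.

Definition ereal_convex J : Prop :=
  forall (u v : X) (l : R), (0 <= l <= 1)%R ->
    J (l *: u + (1 - l) *: v)%R <= l%:E * J u + (1 - l)%:E * J v.

Definition proper_functional J : Prop :=
  (exists u, J u != +oo) /\ (forall u, J u != -oo).

(* As 0 * +oo = 0 in \bar R, the case c = 0 says J 0 = 0. *)
Definition absolutely_one_homogeneous J : Prop :=
  forall (c : R) (u : X), J (c *: u)%R = `|c|%:E * J u.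

Definition nullspace J : set X := [set u | J u = 0].

Definition minimizer (E : X -> \bar R) (u : X) : Prop :=
  forall v, E u <= E v.

Definition unique_minimizer (E : X -> \bar R) (u : X) : Prop :=
  minimizer E u /\ forall v, minimizer E v -> v = u.

End functionals.

Definition norm_on (R : realType) (X : lmodType R) (V : set X)
    (q : X -> R) : Prop :=
  [/\ forall u, V u -> 0 <= q u,
      forall u, V u -> q u = 0 -> u = 0,
      forall (c : R) u, V u -> q (c *: u) = `|c| * q u &
      forall u v, V u -> V v -> q (u + v) <= q u + q v].

Definition equivalent_on (R : realType) (X : Type) (V : set X)
    (p q : X -> R) : Prop :=
  exists c C : R, [/\ 0 < c, 0 < C &
    forall u, V u -> c * p u <= q u /\ q u <= C * p u].

Section projection.
Context {R : realType} {X H : normedModType R}.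
Variables (A : X -> H) (J : X -> \bar R).

Definition nullspace_lsq (g : H) : set X :=
  [set p | nullspace J p /\
           forall u, nullspace J u -> `|A p - g| <= `|A u - g|].

(* P^A(g); the default value 0 is only taken when no minimizer exists. *)
Definition nullspace_proj (g : H) : X := xget 0 (nullspace_lsq g).

End projection.

Section energy.
Context {R : realType} {X H : normedModType R}.
Variables (dot : H -> H -> R) (A : X -> H) (J : X -> \bar R).
Local Open Scope ereal_scope.

Definition A_orthogonal (U : set X) : set X :=
  [set v | forall u, U u -> dot (A v) (A u) = 0%R].

(* The case J u = +oo is separate because 0 * +oo = 0 in \bar R. *)
Definition energy (alpha t : R) (f : H) (u : X) : \bar R :=
  if J u == +oo then +oo
  else (alpha^-1 * `|A u - f| `^ alpha)%:E + t%:E * J u.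

(* S(f), with the convention sup set0 = -oo of \bar R. *)
Definition extinction_sup (f : H) : \bar R :=
  ereal_sup [set (dot f (A u))%:E |
    u in A_orthogonal (nullspace J) `&` [set u | J u = 1]].

(* t_** *)
Definition extinction_time (alpha : R) (f : H) : \bar R :=
  let r := (f - A (nullspace_proj A J f))%R in
  if f != A (nullspace_proj A J f)
  then extinction_sup f / (`|r| `^ (2 - alpha))%:E
  else 0.

End energy.

(* Main.v *)
Require Import Defs.
From mathcomp Require Import all_boot all_order all_algebra.
From mathcomp Require Import all_classical all_reals all_analysis.
From mathcomp Require Import ring lra.

Set Implicit Arguments.
Unset Strict Implicit.
Unset Printing Implicit Defensive.

Import Order.TTheory GRing.Theory Num.Theory.
Import numFieldNormedType.Exports.

Local Open Scope classical_set_scope.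
Local Open Scope ring_scope.

(** Write P for the projection of f, r = f - A P for the residual and N for the
nullspace of J.

The projection.  N is a linear subspace, because J is convex and
one-homogeneous, and it is norm closed, because J is weak-star lower
semicontinuous and weak-star open sets are norm open.  A minimizing sequence of
|A u - g| over N has Cauchy images by the parallelogram law; since |A u|
controls |u| on N, the sequence is itself Cauchy, and its limit stays in the
closed set N ([lsq_exists]).  Hence the projection is the unique point of N
whose residual is orthogonal to A(N).  The assumption on f says exactly that
r <> 0.

Reduction to the A-orthogonal complement of N.  Replacing v by
w = v - P^A(A v) changes neither J nor, by orthogonality, the product
<r, A (v - P)> = <f, A w> ([dot_residual]).  As w is A-orthogonal to N, scaling
it to J = 1 gives <f, A w> <= S(f) J(v) ([dot_le_extinction_sup]).  For such w
coercivity reads |w| <= C J(w), which is why S(f) is finite.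

Optimality.  The fidelity h |-> |r - h|^alpha / alpha is convex with slope
-|r|^(alpha - 2) <r, h> at h = 0.  Its tangent at 0 bounds it from below, so
moving from P to v lowers the fidelity by at most
|r|^(alpha - 2) S(f) J(v) = t_** J(v) ([fidelity_gap]), while the penalty t J(v)
is added: P is optimal as soon as t >= t_**.  If t > t_** the balance is strict
unless J(v) = 0, and among the points of N only P minimizes the fidelity.
Conversely, if P is optimal, comparing it with P + e u for u A-orthogonal to N
with J(u) = 1, and letting e decrease to 0, gives
<f, A u> <= t |r|^(2 - alpha) ([fidelity_slope_le]); taking the supremum over u
gives t_** <= t. *)

(** * Powers *)

(** For alpha > 1 this is Young's inequality for the product of b and
a^(alpha - 1), with exponents alpha and alpha / (alpha - 1). *)
Lemma powR_tangent_le (R : realType) (alpha a b : R) :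
  1 <= alpha -> 0 < a -> 0 <= b ->
  alpha^-1 * a `^ alpha + a `^ (alpha - 1) * (b - a) <= alpha^-1 * b `^ alpha.
Proof.
rewrite le_eqVlt => /predU1P[<-|alpha1] a0 b0.
  by rewrite subrr invr1 !mul1r !powRr1 ?(ltW a0)// powRr0 mul1r addrC subrK.
have alpha0 : 0 < alpha by exact: lt_trans alpha1.
have alpha10 : 0 < alpha - 1 by rewrite subr_gt0.
have := @conjugate_powR R b (a `^ (alpha - 1)) alpha (alpha / (alpha - 1))
  b0 (powR_ge0 _ _) alpha0 (divr_gt0 alpha0 alpha10).
have -> : alpha^-1 + (alpha / (alpha - 1))^-1 = 1 by field; lra.
rewrite -powRrM mulrCA divff ?gt_eqF// mulr1 => /(_ erefl).
have <- : a `^ (alpha - 1) * a = a `^ alpha.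
  rewrite -[X in _ * X]powRr1 ?ltW// -powRD ?subrK//.
  by apply/implyP => _; rewrite gt_eqF.
set p := a `^ _; rewrite mulrBr => young.
have -> : alpha^-1 * (p * a) + (p * b - p * a)
          = b * p - p * a / (alpha / (alpha - 1)) by field; lra.
rewrite lerBlDr; apply: le_trans young _; rewrite lerD2r mulrC//.
Qed.

Lemma powR_continuous_at (R : realType) (beta a : R) :
  0 < a -> {for a, continuous (@powR R ^~ beta)}.
Proof.
move=> a0; apply: differentiable_continuous.
by apply/derivable1_diffP; have [] := is_derive1_powR beta a0.
Qed.

(** * Inner products *)

Section inner_product.
Context {R : realType} {H : normedModType R} (dot : {dot H for idfun}).
Context (H_norm : norm_of_dot dot).
Implicit Types g h k : H.

Lemma dotC g h : dot g h = dot h g.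
Proof. by rewrite (hermC dot) expr0 mul1r. Qed.

Lemma dotDl g h k : dot (g + h) k = dot g k + dot h k.
Proof. exact: linearDl. Qed.

Lemma dotZl (c : R) g h : dot (c *: g) h = c * dot g h.
Proof. exact: linearZl_LR. Qed.

Lemma dotNl g h : dot (- g) h = - dot g h.
Proof. exact: linearNl. Qed.

Lemma dot0l h : dot 0 h = 0.
Proof. exact: linear0l. Qed.

Lemma dotDr g h k : dot g (h + k) = dot g h + dot g k.
Proof. by rewrite dotC dotDl !(dotC _ g). Qed.

Lemma dotZr (c : R) g h : dot g (c *: h) = c * dot g h.
Proof. by rewrite dotC dotZl dotC. Qed.

Lemma dotNr g h : dot g (- h) = - dot g h.
Proof. by rewrite dotC dotNl dotC. Qed.

Lemma normsq_dot h : `|h| ^+ 2 = dot h h.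
Proof.
rewrite H_norm sqr_sqrtr//; have [->|/neq0_dnorm_gt0/ltW//] := eqVneq h 0.
by rewrite dot0l.
Qed.

Lemma normsqD g h : `|g + h| ^+ 2 = `|g| ^+ 2 + 2 * dot g h + `|h| ^+ 2.
Proof. by rewrite !normsq_dot dotDl !dotDr (dotC h g); ring. Qed.

(** Cauchy-Schwarz, by expanding the square of | |h| g - |g| h |. *)
Lemma dot_le_norm g h : dot g h <= `|g| * `|h|.
Proof.
have [->|g0] := eqVneq g 0.
  by rewrite dot0l normr0 mul0r.
have [->|h0] := eqVneq h 0.
  by rewrite dotC dot0l normr0 mulr0.
have : 0 <= `| `|h| *: g - `|g| *: h| ^+ 2 by rewrite exprn_ge0.
rewrite normsqD normrN !normrZ !normr_id dotNr dotZl dotZr.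
have -> : (`|h| * `|g|) ^+ 2 + 2 * - (`|h| * (`|g| * dot g h))
     + (`|g| * `|h|) ^+ 2 = 2 * (`|g| * `|h|) * (`|g| * `|h| - dot g h) by ring.
by rewrite pmulr_rge0 ?subr_ge0// !mulr_gt0 ?normr_gt0.
Qed.

End inner_product.

(** * Tangent and slope of the fidelity *)

Section fidelity.
Context {R : realType} {H : normedModType R} (dot : {dot H for idfun}).
Context (H_norm : norm_of_dot dot) (alpha : R) (alpha_ge1 : 1 <= alpha).
Context (r h : H) (r_neq0 : r != 0).

(** The scalar tangent inequality at |r| leaves |r| (|r - h| - |r|) to be
bounded below by - <r, h>, which is Cauchy-Schwarz for r and r - h. *)
Lemma fidelity_tangent_le :
  alpha^-1 * `|r| `^ alpha - `|r| `^ (alpha - 2) * dot r h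
  <= alpha^-1 * `|r - h| `^ alpha.
Proof.
have r0 : 0 < `|r| by rewrite normr_gt0.
apply: le_trans (powR_tangent_le alpha_ge1 r0 (normr_ge0 (r - h))).
have -> : `|r| `^ (alpha - 1) = `|r| `^ (alpha - 2) * `|r|.
  rewrite -[X in _ * X]powRr1// -powRD; first by congr powR; ring.
  by apply/implyP => _; rewrite gt_eqF.
rewrite lerD2l -mulrA -mulrN ler_wpM2l ?powR_ge0// mulrBr -expr2.
rewrite (normsq_dot H_norm) lerBrDl -dotNr -dotDr.
exact: dot_le_norm.
Qed.

(** The penalty t e must compensate the first-order decrease of the fidelity in
the direction h.  The decrease is estimated through the tangent at the nearby
point r - e h, so that only the continuity of the norm and of the power at
|r| > 0 is needed to pass to the limit. *)
Lemma fidelity_slope_le (t : R) :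
  (forall e, 0 < e ->
    alpha^-1 * `|r| `^ alpha <= alpha^-1 * `|r - e *: h| `^ alpha + t * e) ->
  dot r h <= t * `|r| `^ (2 - alpha).
Proof.
move=> slope; have r0 : 0 < `|r| by rewrite normr_gt0.
pose b e := `|r - e *: h|.
have b_cvg : b e @[e --> 0^'+] --> `|r|.
  apply: cvg_at_right_filter; apply: cvg_norm.
  rewrite -[X in _ --> X]subr0 -(scale0r h).
  apply: cvgB; [exact: cvg_cst|]; apply: cvgZr_tmp; exact: cvg_id.
(* Tangent inequality at |r - e h|, divided by e and multiplied by
   |r| + |r - e h| so as to turn |r| - |r - e h| into a difference of squares,
   in the limit e -> 0. *)
have : `|r| `^ (alpha - 1) * (2 * dot r h - 0 * `|h| ^+ 2)
       - t * (`|r| + `|r|) <= 0.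
  apply: (@cvgr_to_le _ (0^'+) _ _ (fun e => b e `^ (alpha - 1) *
     (2 * dot r h - e * `|h| ^+ 2) - t * (`|r| + b e))).
    apply: cvgB; last first.
      by apply: cvgMl_tmp; apply: cvgD => //; exact: cvg_cst.
    apply: cvgM.
      exact: cvg_comp _ _ b_cvg (powR_continuous_at r0).
    apply: cvgB; first exact: cvg_cst.
    by apply: cvgMr_tmp; apply: cvg_at_right_filter; exact: cvg_id.
  near=> e.
  have e0 : 0 < e by [].
  have b0 : 0 < b e by near: e; exact: cvgr_gt b_cvg _ r0.
  have := powR_tangent_le alpha_ge1 b0 (normr_ge0 r).
  move=> /le_trans /(_ (slope e e0)); rewrite lerD2l => le_te.
  have normsq_b : b e ^+ 2 = `|r| ^+ 2 - 2 * (e * dot r h) + (e * `|h|) ^+ 2.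
    rewrite (normsqD H_norm) dotNr dotZr normrN normrZ gtr0_norm//.
    by rewrite mulrN.
  have ab0 : 0 < `|r| + b e by rewrite addr_gt0.
  rewrite subr_le0 -(ler_pM2l e0).
  rewrite [leLHS](_ : _ = b e `^ (alpha - 1) * (`|r| - b e) * (`|r| + b e)).
    by rewrite mulrA [e * t]mulrC ler_wpM2r// ltW.
  rewrite -mulrA -subr_sqr normsq_b; move: (dot r h) (b e `^ _) => k p; ring.
have rE : `|r| `^ (alpha - 1) * `|r| `^ (2 - alpha) = `|r|.
  rewrite -powRD; last by apply/implyP => _; rewrite gt_eqF.
  by rewrite (_ : _ + _ = 1) ?powRr1//; ring.
have p0 : 0 < `|r| `^ (alpha - 1) by exact: powR_gt0.
move: rE p0; set p := `|r| `^ _; set q := `|r| `^ _ => <- p0.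
rewrite -[leRHS](mulr0 (2 * p)) => le0.
rewrite -subr_le0 -(@ler_pM2l _ (2 * p)) ?mulr_gt0//.
by apply: le_trans le0; rewrite le_eqVlt; apply/orP/or_introl/eqP; ring.
Unshelve. all: end_near. Qed.

End fidelity.

(** * The nullspace of a convex one-homogeneous functional *)

Section one_homogeneous.
Context {R : realType} {X : lmodType R} (J : X -> \bar R).
Context (J_ge0 : forall u, (0 <= J u)%E) (J_convex : ereal_convex J).
Context (J_homogeneous : absolutely_one_homogeneous J).
Implicit Types u v n : X.

(** u + v is the midpoint of 2 u and 2 v. *)
Lemma subadditive_of_convex u v : (J (u + v) <= J u + J v)%E.
Proof.
have half01 : 0 <= (2^-1 : R) <= 1 by lra.
have := J_convex (2 *: u) (2 *: v) half01.
have -> : 1 - 2^-1 = 2^-1 :> R by lra.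
rewrite !scalerA mulVf ?pnatr_eq0// !scale1r => /le_trans; apply.
by rewrite !J_homogeneous !muleA -!EFinM normr_nat mulVf ?pnatr_eq0// !mul1e.
Qed.

Lemma nullspace0 : nullspace J 0.
Proof.
by rewrite /nullspace/= -(scale0r (0 : X)) J_homogeneous normr0 mul0e.
Qed.

Lemma nullspaceZ (c : R) u : nullspace J u -> nullspace J (c *: u).
Proof. by rewrite /nullspace/= J_homogeneous => ->; rewrite mule0. Qed.

Lemma nullspaceD u v : nullspace J u -> nullspace J v -> nullspace J (u + v).
Proof.
rewrite /nullspace/= => Ju Jv; apply/eqP; rewrite eq_le J_ge0 andbT.
by have := subadditive_of_convex u v; rewrite Ju Jv adde0.
Qed.

Lemma nullspaceN u : nullspace J u -> nullspace J (- u).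
Proof. by rewrite -scaleN1r; exact: nullspaceZ. Qed.

Lemma nullspaceB u v : nullspace J u -> nullspace J v -> nullspace J (u - v).
Proof. by move=> Ju Jv; exact/nullspaceD/nullspaceN. Qed.

Lemma J_addr_nullspace u n : nullspace J n -> J (u + n) = J u.
Proof.
move=> Jn; apply/eqP; rewrite eq_le; apply/andP; split.
  by rewrite (le_trans (subadditive_of_convex _ _))// Jn adde0.
rewrite -{1}(addrK n u) (le_trans (subadditive_of_convex _ _))//.
by rewrite (nullspaceN Jn) adde0.
Qed.

End one_homogeneous.

(** * Weak-star topology of a dual space *)

Section weak_star.
Context {R : realType} {Y X : normedModType R} (pairing : X -> Y -> R).
Context (X_dual : is_dual_of pairing).

Lemma pairingZ x (c : R) y : pairing x (c *: y) = c * pairing x y.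
Proof.
have p0 : pairing x 0 = 0.
  have := dual_scalar X_dual x 1 0 0.
  by rewrite scale1r mul1r addr0 -[LHS]addr0 => /addrI.
by have := dual_scalar X_dual x c y 0; rewrite !addr0 p0 addr0.
Qed.

(** On an unbounded set sup takes a default value; boundedness makes the norm of
x an actual upper bound of the values of x on the unit ball. *)
Lemma pairing_unit_bounded x :
  has_ubound [set `|pairing x y| | y in [set y | `|y| <= 1]].
Proof.
have p0 : pairing x 0 = 0 by rewrite -(scale0r (0 : Y)) pairingZ mul0r.
have /cvgrPdist_le /(_ 1 ltr01) := @dual_continuous _ _ _ _ X_dual x 0.
move=> /nbhs_ballP[d /= d0 pd]; exists (2 / d) => _ [y /= y1 <-].
have := pd (d / 2 *: y).
rewrite p0 sub0r normrN pairingZ normrM gtr0_norm ?divr_gt0//.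
rewrite -ball_normE /= sub0r normrN normrZ gtr0_norm ?divr_gt0// => pdy.
rewrite -ler_pdivlMl ?divr_gt0// in pdy.
rewrite (le_trans (pdy _)) ?mulr1 ?invf_div//.
by rewrite (@le_lt_trans _ _ (d / 2)) ?ler_piMr ?(ltW (divr_gt0 _ _))//; lra.
Qed.

Lemma pairing_le_norm x y : `|pairing x y| <= `|x| * `|y|.
Proof.
have [->|y0] := eqVneq y 0.
  by rewrite -(scale0r (0 : Y)) pairingZ mul0r !normr0 scale0r normr0 mulr0.
have ny0 : 0 < `|y| by rewrite normr_gt0.
rewrite -ler_pdivrMr// (dual_norm X_dual x) mulrC.
rewrite -[leLHS](_ : `|pairing x (`|y|^-1 *: y)| = _); last first.
  by rewrite pairingZ normrM normfV normr_id.
apply: ub_le_sup; first exact: pairing_unit_bounded.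
by exists (`|y|^-1 *: y) => //=; rewrite normrZ normfV normr_id mulVf ?gt_eqF.
Qed.

Lemma pairingBl x x' y : pairing (x - x') y = pairing x y - pairing x' y.
Proof.
rewrite [x - x']addrC -scaleN1r.
by have /= -> := dual_linear X_dual y (-1) x' x; rewrite mulN1r addrC.
Qed.

Lemma pairing_continuousl y : continuous (pairing ^~ y).
Proof.
have y1 : 0 < `|y| + 1 by rewrite ltr_wpDl.
move=> x; apply/cvgrPdist_le => e e0; near=> x'.
rewrite -pairingBl (le_trans (pairing_le_norm _ _))//.
rewrite (@le_trans _ _ (e / (`|y| + 1) * `|y|))//.
  rewrite ler_wpM2r//; near: x'.
  have /cvgrPdist_le /(_ _ (divr_gt0 e0 y1)) near_x := @cvg_id _ (nbhs x).
  exact: near_x.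
by rewrite mulrAC ler_pdivrMr// ler_pM2l// lerDl.
Unshelve. all: end_near. Qed.

Lemma weak_star_open_norm_open (U : set X) :
  open (U : set (weak_star pairing)) -> open U.
Proof.
move=> [B oB <-]; move: B oB; apply/continuousP => x.
by apply/pointwise_cvgP => y; exact: pairing_continuousl.
Qed.

(** The complement of the nullspace is the superlevel set J > 0. *)
Lemma nullspace_closed (J : X -> \bar R) : (forall u, (0 <= J u)%E) ->
  weak_star_lsc pairing J -> closed (nullspace J).
Proof.
move=> J_ge0 /lower_semicontinuousP /(_ 0) /weak_star_open_norm_open.
move=> /open_closedC; congr closed; apply/seteqP; split => u /=.
  by move/negP; rewrite -leNgt => Ju; apply/eqP; rewrite eq_le Ju J_ge0.
by rewrite /nullspace/= => ->; rewrite ltxx.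
Qed.

End weak_star.

(** * Least squares over the nullspace *)

Section extinction.
Context {R : realType} {X : completeNormedModType R} {H : normedModType R}.
Context (dot : {dot H for idfun}) (H_norm : norm_of_dot dot).
Context (A : {linear X -> H}) (A_bounded : bounded_operator A).
Context (J : X -> \bar R) (J_ge0 : forall u, (0 <= J u)%E).
Context (J_convex : ereal_convex J).
Context (J_homogeneous : absolutely_one_homogeneous J).
Context (N_closed : closed (nullspace J)).
Context (A_norm : norm_on (nullspace J) (fun u => `|A u|)).
Context (A_equiv :
  equivalent_on (nullspace J) (fun u => `|u|) (fun u => `|A u|)).
Implicit Types (g : H) (u v p q : X).

Lemma bounded_operator_continuous : continuous A.
Proof.
have [M AM] := A_bounded.
apply: bounded_linear_continuous; apply/bounded_funP => s.
exists (`|M| * s) => u us; rewrite (le_trans (AM u))//.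
by rewrite (le_trans (ler_wpM2r _ (ler_norm M)))// ler_wpM2l.
Qed.

(** Moving from p by s u changes the squared distance by a quadratic in s whose
linear coefficient is -2 k, so k must vanish. *)
Lemma lsq_orthogonal g p u : nullspace_lsq A J g p -> nullspace J u ->
  dot (g - A p) (A u) = 0.
Proof.
move=> [Jp p_min] Ju; set k := dot _ _.
pose q := `|A u| ^+ 2; have q0 : 0 <= q by rewrite exprn_ge0.
(* The step k / q of the exact line search, with q + 1 in place of q so that
   A u = 0 needs no separate treatment. *)
pose s := k / (q + 1).
have := p_min (p + s *: u).
have -> : A (p + s *: u) - g = (A p - g) + s *: A u.
  by rewrite linearD linearZ addrAC.
move=> /(_ (nullspaceD J_ge0 J_convex J_homogeneous Jp
               (nullspaceZ J_homogeneous s Ju))).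
rewrite -(@ler_pXn2r _ 2)// ?nnegrE// [leRHS](normsqD H_norm) -addrA lerDl.
rewrite dotZr -(opprB g) dotNl -/k normrZ exprMn real_normK ?num_real// -/q.
have -> : 2 * (s * - k) + s ^+ 2 * q = - (k ^+ 2 * (q + 2) / (q + 1) ^+ 2).
  by rewrite /s; field; lra.
rewrite oppr_ge0 => k_le0; apply/eqP; rewrite -sqrf_eq0 eq_le sqr_ge0 andbT.
by move: k_le0; rewrite -mulrA pmulr_lle0// divr_gt0 ?exprn_gt0//; lra.
Qed.

Lemma lsq_pythagoras g p u : nullspace J p ->
  (forall v, nullspace J v -> dot (g - A p) (A v) = 0) -> nullspace J u ->
  `|A u - g| ^+ 2 = `|A p - g| ^+ 2 + `|A (u - p)| ^+ 2.
Proof.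
move=> Jp orth Ju.
rewrite linearB -[A u - g](subrKA (A p)) [LHS](normsqD H_norm).
rewrite [dot _ _]dotC -[A p - g]opprB dotNl -linearB orth;
  last exact: nullspaceB.
by rewrite oppr0 mulr0 addr0 addrC.
Qed.

Lemma orthogonal_lsq g p : nullspace J p ->
  (forall v, nullspace J v -> dot (g - A p) (A v) = 0) ->
  nullspace_lsq A J g p.
Proof.
move=> Jp orth; split => // u Ju; rewrite -(@ler_pXn2r _ 2)// ?nnegrE//.
by rewrite (lsq_pythagoras Jp orth Ju) lerDl exprn_ge0.
Qed.

Lemma lsq_unique g p q :
  nullspace_lsq A J g p -> nullspace_lsq A J g q -> q = p.
Proof.
move=> lsq_p lsq_q; have [[Jp _] [Jq q_min]] := (lsq_p, lsq_q).
have /(_ _) orth := fun v => @lsq_orthogonal g p v lsq_p.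
have := q_min p Jp; rewrite -(@ler_pXn2r _ 2)// ?nnegrE//.
rewrite (lsq_pythagoras Jp orth Jq) gerDl => A0.
have [_ A_inj _ _] := A_norm.
apply/eqP; rewrite -subr_eq0; apply/eqP/A_inj; first exact: nullspaceB.
by apply/eqP; rewrite -sqrf_eq0 eq_le A0 exprn_ge0.
Qed.

(** The lower bound c |u| <= |A u| on the nullspace transfers the Cauchy
property from the images of a minimizing sequence to the sequence, which then
converges in X. *)
Lemma lsq_exists g : exists p, nullspace_lsq A J g p.
Proof.
have [c [C [c0 _ cA]]] := A_equiv.
pose E := [set `|A u - g| ^+ 2 | u in nullspace J].
have E_inf : has_inf E.
  split; last by exists 0 => _ [u _ <-]; rewrite exprn_ge0.
  by exists (`|A 0 - g| ^+ 2), 0 => //; exact: nullspace0.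
pose d := inf E.
have d_le u : nullspace J u -> d <= `|A u - g| ^+ 2.
  by move=> Ju; apply: ge_inf; [case: E_inf|exists u].
(* Parallelogram law: d bounds the squared distance of the midpoint. *)
have close u v e : nullspace J u -> nullspace J v ->
    `|A u - g| ^+ 2 < d + e -> `|A v - g| ^+ 2 < d + e ->
    (c * `|u - v|) ^+ 2 < 4 * e.
  move=> Ju Jv ue ve; have Juv := nullspaceB J_ge0 J_convex J_homogeneous Ju Jv.
  apply: (@le_lt_trans _ _ (`|A (u - v)| ^+ 2)).
    by rewrite ler_pXn2r ?nnegrE ?mulr_ge0 ?(ltW c0)//; case: (cA _ Juv).
  have /d_le : nullspace J (2^-1 *: (u + v)).
    exact/nullspaceZ/nullspaceD.
  have -> : A (2^-1 *: (u + v)) - g = 2^-1 *: ((A u - g) + (A v - g)).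
    rewrite linearZ linearD addrACA -opprD scalerBr -mulr2n -[g *+ 2]scaler_nat.
    by rewrite scalerA mulVf ?pnatr_eq0// scale1r.
  have -> : A (u - v) = (A u - g) - (A v - g).
    by rewrite linearB opprB addrA subrK.
  move: (A u - g) (A v - g) ue ve => a b ue ve.
  rewrite normrZ exprMn !(normsqD H_norm) dotNr normrN ger0_norm ?invr_ge0//.
  by rewrite expr2; lra.
have /choice[x x_min] n : exists u, nullspace J u /\
    `|A u - g| ^+ 2 < d + n.+1%:R^-1.
  have n0 : 0 < n.+1%:R^-1 :> R by rewrite invr_gt0.
  by have [_ [u Ju <-] ue] := inf_adherent n0 E_inf; exists u.
have x_tail e : 0 < e -> \forall n \near \oo, `|A (x n) - g| ^+ 2 < d + e.
  move=> e0; near=> n; have [_ /lt_trans -> //] := x_min n.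
  rewrite ltrD2l; near: n; exact: (near_infty_natSinv_lt (PosNum e0)).
have /cauchy_cvgP x_cvg : cauchy (x @ \oo).
  apply: cauchy_exP => e e0.
  have e'0 : 0 < (c * e) ^+ 2 / 4 by rewrite divr_gt0 ?exprn_gt0 ?mulr_gt0.
  have [m _ xm] := x_tail _ e'0; exists (x m).
  suff : \forall n \near \oo, ball (x m) e (x n) by [].
  near=> n; rewrite -ball_normE/=.
  rewrite -(ltr_pM2l c0) -(@ltr_pXn2r _ 2) ?nnegrE ?mulr_ge0 ?(ltW c0)//;
    last exact: ltW.
  rewrite -[ltRHS](@divfK _ 4)// [ltRHS]mulrC; apply: close.
  - by case: (x_min m).
  - by case: (x_min n).
  - exact: xm (leqnn m).
  - by near: n; exact: x_tail.
pose p := lim (x @ \oo); exists p.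
have Jp : nullspace J p.
  apply: (closed_cvg _ N_closed _ _ x_cvg).
  by near=> n; case: (x_min n).
have Ax_cvg : `|A (x n) - g| @[n --> \oo] --> `|A p - g|.
  apply: cvg_norm; apply: cvgB; last exact: cvg_cst.
  exact: (cvg_comp _ _ x_cvg (@bounded_operator_continuous p)).
split=> // u Ju; rewrite -(@ler_pXn2r _ 2)// ?nnegrE//.
apply: le_trans (d_le _ Ju); apply/ler_addgt0Pr => e e0.
apply: (@cvgr_to_le _ \oo _ _ (fun n => `|A (x n) - g| ^+ 2)).
  by apply: cvgM; exact: Ax_cvg.
by near=> n; apply: ltW; near: n; exact: x_tail.
Unshelve. all: end_near. Qed.

Lemma nullspace_projP g : nullspace_lsq A J g (nullspace_proj A J g).
Proof. by apply: xgetPex; exact: lsq_exists. Qed.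

Lemma nullspace_proj_eq g p : nullspace_lsq A J g p -> nullspace_proj A J g = p.
Proof. by move=> /lsq_unique; apply; exact: nullspace_projP. Qed.

Lemma nullspace_proj_null g : nullspace J (nullspace_proj A J g).
Proof. by case: (nullspace_projP g). Qed.

Lemma nullspace_proj_orthogonal u :
  A_orthogonal dot A (nullspace J) u -> nullspace_proj A J (A u) = 0.
Proof.
move=> orth; apply: nullspace_proj_eq; apply: orthogonal_lsq.
  exact: nullspace0.
by move=> v Jv; rewrite linear0 subr0 orth.
Qed.

Lemma subr_nullspace_proj_orthogonal u :
  A_orthogonal dot A (nullspace J) (u - nullspace_proj A J (A u)).
Proof.
by move=> v Jv; rewrite linearB lsq_orthogonal//; exact: nullspace_projP.
Qed.

(** * Extinction *)

Context (C : R) (J_coercive :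
  forall u, (`|u - nullspace_proj A J (A u)|%:E <= C%:E * J u)%E).
Context (f : H) (f_datum : forall u, A u = f -> J u <> 0%E).
Context (alpha : R) (alpha_ge1 : 1 <= alpha).

Let P := nullspace_proj A J f.
Let tss := extinction_time dot A J alpha f.

Lemma residual_neq0 : f - A P != 0.
Proof.
rewrite subr_eq0; apply/eqP => /esym/f_datum; apply.
exact: nullspace_proj_null.
Qed.

(** On the A-orthogonal complement the projection of A u is 0, so coercivity
bounds |u| by C J(u) = C. *)
Lemma extinction_sup_lty : (extinction_sup dot A J f < +oo)%E.
Proof.
have [M AM] := A_bounded.
apply: (@le_lt_trans _ _ (`|f| * (`|M| * C))%:E); last exact: ltry.
apply: ge_ereal_sup => _ [u [/nullspace_proj_orthogonal Pu Ju] <-].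
have := J_coercive u; rewrite Pu subr0 [J u]Ju mule1 !lee_fin => uC.
rewrite (le_trans (dot_le_norm H_norm _ _))// ler_wpM2l//.
rewrite (le_trans (AM u))// (le_trans (ler_wpM2r _ (ler_norm M)))//.
exact: ler_wpM2l.
Qed.

(** The test directions v - P and w = v - P^A(A v) differ by an element of N,
whose image is orthogonal to r; and A P is orthogonal to A w. *)
Lemma dot_residual v :
  dot (f - A P) (A (v - P)) = dot f (A (v - nullspace_proj A J (A v))).
Proof.
pose q := nullspace_proj A J (A v).
have Jq : nullspace J q by exact: nullspace_proj_null.
have JP : nullspace J P by exact: nullspace_proj_null.
rewrite -(subrKA q) linearD dotDr.
rewrite (@lsq_orthogonal _ _ (q - P) (nullspace_projP f));
  last exact: nullspaceB.
rewrite addr0 dotDl dotNl [dot (A P) _]dotC.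
by rewrite (subr_nullspace_proj_orthogonal v JP) subr0.
Qed.

(** The bound s may be negative: when no admissible u exists, the supremum is
-oo.  In that case J(v) = 0, and coercivity makes both sides vanish. *)
Lemma dot_le_extinction_sup s v j :
  (extinction_sup dot A J f <= s%:E)%E -> J v = j%:E ->
  dot f (A (v - nullspace_proj A J (A v))) <= s * j.
Proof.
move=> S_le Jv; set w := v - _.
have Jw : J w = j%:E.
  by rewrite J_addr_nullspace//; exact/nullspaceN/nullspace_proj_null.
have : 0 <= j by rewrite -lee_fin -Jv.
rewrite le_eqVlt => /predU1P[j0|j0].
  have := J_coercive v; rewrite Jv -j0 mule0 lee_fin normr_le0 => /eqP w0.
  by rewrite /w w0 linear0 dotC dot0l mulr0.
rewrite -ler_pdivrMr// mulrC -dotZr -linearZ -lee_fin.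
apply: le_trans S_le; apply: ereal_sup_ubound; exists (j^-1 *: w) => //; split.
  move=> u Ju; rewrite linearZ dotZl.
  by rewrite (subr_nullspace_proj_orthogonal v Ju) mulr0.
by rewrite /= J_homogeneous Jw -EFinM gtr0_norm ?invr_gt0// mulVf ?gt_eqF.
Qed.

Lemma extinction_time_leE t :
  (tss <= t%:E)%E =
  (extinction_sup dot A J f <= (t * `|f - A P| `^ (2 - alpha))%:E)%E.
Proof.
have r0 : 0 < `|f - A P| by rewrite normr_gt0 residual_neq0.
rewrite /tss /extinction_time -/P -subr_eq0 residual_neq0.
by rewrite inver gt_eqF ?powR_gt0// lee_pdivrMr ?powR_gt0.
Qed.

Lemma energyE t v j : J v = j%:E ->
  energy A J alpha t f v = (alpha^-1 * `|A v - f| `^ alpha + t * j)%:E.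
Proof. by rewrite /energy => ->. Qed.

Lemma energy_projE t :
  energy A J alpha t f P = (alpha^-1 * `|f - A P| `^ alpha)%:E.
Proof.
by rewrite (energyE _ (nullspace_proj_null _)) mulr0 addr0 distrC.
Qed.

(** The t of this estimate is unrelated to the regularization parameter of the
energy and may be negative, so that it can be chosen below any parameter that
exceeds t_**, even when t_** = -oo. *)
Lemma fidelity_gap t v j : (tss <= t%:E)%E -> J v = j%:E ->
  alpha^-1 * `|f - A P| `^ alpha <= alpha^-1 * `|A v - f| `^ alpha + t * j.
Proof.
rewrite extinction_time_leE => /dot_le_extinction_sup dot_le /dot_le.
rewrite -dot_residual => {}dot_le; have r0 := residual_neq0.
have := fidelity_tangent_le H_norm alpha_ge1 (A (v - P)) r0.
rewrite {2}linearB opprB addrA subrK [`|f - A v|]distrC lerBlDr.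
move=> /le_trans; apply.
rewrite lerD2l; apply: le_trans (ler_wpM2l (powR_ge0 _ _) dot_le) _.
rewrite mulrA [X in X * _]mulrCA -powRD; last first.
  by apply/implyP => _; rewrite normr_eq0.
by rewrite (_ : alpha - 2 + (2 - alpha) = 0) ?powRr0 ?mulr1//; ring.
Qed.

Lemma finite_or_infinite u : J u = +oo%E \/ exists2 j, 0 <= j & J u = j%:E.
Proof.
have := J_ge0 u; case: (J u) => [j j0||//]; last by left.
by right; exists j.
Qed.

Lemma proj_minimizer t : (tss <= t%:E)%E ->
  minimizer (energy A J alpha t f) P.
Proof.
move=> tss_t v; have [Jv|[j _ Jv]] := finite_or_infinite v.
  by rewrite [leRHS]/energy Jv eqxx leey.
by rewrite energy_projE (energyE _ Jv) lee_fin fidelity_gap.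
Qed.

Lemma proj_unique_minimizer t : (tss < t%:E)%E ->
  unique_minimizer (energy A J alpha t f) P.
Proof.
move=> tss_t; split=> [|v /(_ P)]; first exact/proj_minimizer/ltW.
rewrite energy_projE; have [Jv|[j j0 Jv]] := finite_or_infinite v.
  by rewrite /energy Jv eqxx leye_eq.
rewrite (energyE _ Jv) lee_fin => v_le.
have [s st tss_s] : exists2 s, s < t & (tss <= s%:E)%E.
  move: tss_t; case: (tss) => [s||] //; first by exists s.
  by exists (t - 1); [rewrite ltrBlDr ltrDl|exact: leNye].
(* The gap with s < t is strict as soon as J v > 0. *)
have j_eq0 : j = 0.
  apply/eqP; rewrite eq_le j0 andbT leNgt; apply/negP => j_gt0.
  have := le_trans v_le (fidelity_gap tss_s Jv).
  by rewrite lerD2l ler_pM2r// leNgt st.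
(* Now v lies in N with a residual no larger than that of P. *)
move: v_le Jv; rewrite j_eq0 mulr0 addr0 => v_le Jv.
have alpha0 : 0 < alpha by exact: lt_le_trans alpha_ge1.
apply: lsq_unique (nullspace_projP f) _; split=> // u Ju.
have [_ /(_ u Ju)] := nullspace_projP f; apply: le_trans.
rewrite -/P [leRHS]distrC leNgt; apply/negP.
move=> /(gt0_ltr_powR alpha0); rewrite !nnegrE.
move=> /(_ (normr_ge0 _) (normr_ge0 _)).
by rewrite ltNge -(ler_pM2l (_ : 0 < alpha^-1)) ?invr_gt0// v_le.
Qed.

Lemma extinction_time_le_of_minimizer t :
  minimizer (energy A J alpha t f) P -> (tss <= t%:E)%E.
Proof.
move=> P_min; rewrite extinction_time_leE.
apply: ge_ereal_sup => _ [u [u_orth /= Ju] <-]; rewrite lee_fin.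
have JP : nullspace J P by exact: nullspace_proj_null.
have -> : dot f (A u) = dot (f - A P) (A u).
  by rewrite dotDl dotNl [dot (A P) _]dotC u_orth// subr0.
apply: (fidelity_slope_le H_norm alpha_ge1 residual_neq0) => e e0.
have Je : J (P + e *: u) = e%:E.
  by rewrite addrC J_addr_nullspace// J_homogeneous Ju mule1 gtr0_norm.
have := P_min (P + e *: u).
rewrite energy_projE (energyE _ Je) lee_fin linearD linearZ.
by rewrite [`|_ + _ - f|]distrC opprD addrA.
Qed.

End extinction.

Theorem theorem2p14 (R : realType)
    (* X is the dual of the separable Banach space Y *)
    (Y X : completeNormedModType R) (pairing : X -> Y -> R)
    (Y_separable : separable_space Y)
    (X_dual : is_dual_of pairing)
    (* H is a real Hilbert space *)
    (H : completeNormedModType R) (dot : {dot H for idfun})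
    (H_norm : norm_of_dot dot)
    (A : {linear X -> H}) (A_bounded : bounded_operator A)
    (J : X -> \bar R)
    (J_ge0 : forall u, (0 <= J u)%E)
    (J_convex : ereal_convex J)
    (J_proper : proper_functional J)
    (J_lsc : weak_star_lsc pairing J)
    (J_homogeneous : absolutely_one_homogeneous J)
    (A_norm : norm_on (nullspace J) (fun u => `|A u|))
    (A_equiv : equivalent_on (nullspace J) (fun u => `|u|) (fun u => `|A u|))
    (J_coercive : exists2 C : R, 0 < C &
       forall u, (`|u - nullspace_proj A J (A u)|%:E <= C%:E * J u)%E)
    (A_weak : weak_star_to_weak_continuous pairing A)
    (f : H) (f_datum : forall u, A u = f -> J u <> 0%E)
    (alpha : R) (alpha_ge1 : 1 <= alpha) :
  let P := nullspace_proj A J f in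
  let tss := extinction_time dot A J alpha f in
  [/\ (extinction_sup dot A J f < +oo)%E,
      forall t : R, 0 <= t -> (tss <= t%:E)%E ->
        minimizer (energy A J alpha t f) P,
      forall t : R, 0 <= t -> (tss < t%:E)%E ->
        unique_minimizer (energy A J alpha t f) P &
      forall t : R, 0 <= t -> minimizer (energy A J alpha t f) P ->
        (tss <= t%:E)%E].
Proof.
move=> P tss; have [C _ CJ] := J_coercive.
have N_closed := nullspace_closed X_dual J_ge0 J_lsc.
split.
- exact: extinction_sup_lty CJ _.
- by move=> t _; exact: proj_minimizer CJ _ _ _ _ _.
- by move=> t _; exact: proj_unique_minimizer CJ _ _ _ _ _.
- by move=> t _; exact: extinction_time_le_of_minimizer.
Qed.
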